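(* Let $n\ge 7$ with $n\equiv 1\pmod 6$. Then the Skolem Construction coupled with the Skolem Mapping produces a Steiner triple system of order $n$ with min-sum equal to $n$; that is, $\left([0,n-1],\ \{\pi_S(B): B\in\mathcal{B}'\}\right)$ is a Steiner triple system of order $n$, and the minimum over its blocks of the sum of the elements of the block equals $n$.
   Context: For integers $a\le b$, $[a,b]=\{a,\ldots,b\}$. A Steiner triple system of order $n$ is a pair $(\mathcal{X},\mathcal{B})$ with $|\mathcal{X}|=n$ and $\mathcal{B}$ a collection of 3-subsets (blocks) of $\mathcal{X}$ such that every 2-subset of $\mathcal{X}$ lies in exactly one block. For $\mathcal{X}=[0,n-1]$, the min-sum is $\min_{B\in\mathcal{B}}\sum_{x\in B}x$. Skolem Construction: write $n=3m+1$, $m\ge2$ even. For $x,y\in[0,m-1]$ let $r\in[0,m-1]$ be the residue of $x+y$ modulo $m$, and set $x\oplus_s y=r/2$ if $r$ is even and $x\oplus_s y=(r+m-1)/2$ if $r$ is odd. The point set is $\mathcal{X}'=\{\infty\}\cup\{(x,i): x\in[0,m-1],\ i\in[0,2]\}$, and the block set $\mathcal{B}'$ consists of: (Type 1) $B_x=\{(x,0),(x,1),(x,2)\}$ for $x\in[0,m/2-1]$; (Type 2) $B_{x,y,i}=\{(x,i),(y,i),(x\oplus_s y,\ i+1\bmod 3)\}$ for $0\le x<y\le m-1$, $i\in[0,2]$; (Type 3) $B_{x,i}=\{\infty,(x+m/2,i),(x,\ i+1\bmod 3)\}$ for $x\in[0,m/2-1]$, $i\in[0,2]$. Skolem Mapping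 $\pi_S:\mathcal{X}'\to[0,n-1]$: for $x\in[0,m-1]$, $\pi_S((x,0))=m-1-x$; $\pi_S((x,1))=2m+1$ if $x=m/2-1$, and $\pi_S((x,1))=2m+2+y$ if $x\ne m/2-1$, where $y$ is the unique element of $[0,m-1]$ with $x=(m-1)\oplus_s y$; $\pi_S((x,2))=m+1+(0\oplus_s x)$; and $\pi_S(\infty)=m$. The mapping is applied to each point of each block. *)

(* Defs.v *)
From mathcomp Require Import all_boot.
From mathcomp Require Import finmap zify.

Set Implicit Arguments.
Unset Strict Implicit.
Unset Printing Implicit Defensive.

Local Open Scope fset_scope.
Local Open Scope nat_scope.

Definition steiner_triple_system (K : choiceType) (n : nat)
    (X : {fset K}) (Bs : {fset {fset K}}) : Prop :=
  [/\ #|` X| = n,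
      forall B, B \in Bs -> B `<=` X /\ #|` B| = 3
    & forall P : {fset K}, P `<=` X -> #|` P| = 2 ->
        exists! B : {fset K}, B \in Bs /\ P `<=` B].

Definition block_sum (B : {fset nat}) : nat := \sum_(x <- B) x.

(* The minimum is attained, so no empty block set has a min-sum. *)
Definition is_min_sum (Bs : {fset {fset nat}}) (s : nat) : Prop :=
  (exists2 B, B \in Bs & block_sum B = s) /\
  (forall B, B \in Bs -> s <= block_sum B).

(* [None] is the point at infinity and [Some (x, i)] the point (x, i); only   *)
(* the points with x < m and i < 3 occur in the blocks below.                 *)
Definition skolem_point := option (nat * nat).
Definition infty : skolem_point := None.
Definition pt (x i : nat) : skolem_point := Some (x, i).

Definition skolem_op (m x y : nat) : nat :=
  let r := (x + y) %% m in
  if odd r then (r + m - 1)./2 else r./2.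

Definition skolem_block1 (x : nat) : {fset skolem_point} :=
  [fset pt x 0; pt x 1; pt x 2].

Definition skolem_block2 (m x y i : nat) : {fset skolem_point} :=
  [fset pt x i; pt y i; pt (skolem_op m x y) (i.+1 %% 3)].

Definition skolem_block3 (m x i : nat) : {fset skolem_point} :=
  [fset infty; pt (x + m./2) i; pt x (i.+1 %% 3)].

Definition skolem_blocks (m : nat) : {fset {fset skolem_point}} :=
  [fset skolem_block1 x | x in iota 0 m./2]
  `|` \bigcup_(i <- iota 0 3)
        [fset skolem_block2 m x y i | x in iota 0 m, y in iota 0 m & x < y]
  `|` [fset skolem_block3 m x i | x in iota 0 m./2, i in iota 0 3].

(* The y in [0, m - 1] with x = (m - 1) (+) y, computed as the first one by   *)
(* search; [skolem_solP] shows that it exists and is unique.                  *)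
Definition skolem_sol (m x : nat) : nat :=
  find (fun y => skolem_op m (m - 1) y == x) (iota 0 m).

Definition skolem_map (m : nat) (p : skolem_point) : nat :=
  match p with
  | None => m
  | Some (x, 0) => m - 1 - x
  | Some (x, 1) =>
      if x == m./2 - 1 then 2 * m + 1 else 2 * m + 2 + skolem_sol m x
  | Some (x, _) => m + 1 + skolem_op m 0 x
  end.

Lemma skolem_solP (m x : nat) : ~~ odd m -> x < m ->
  [/\ skolem_sol m x < m,
      skolem_op m (m - 1) (skolem_sol m x) = x
    & forall y, y < m -> skolem_op m (m - 1) y = x -> y = skolem_sol m x].
Proof.
move=> em xm.
have modE y : y < m ->
    (m - 1 + y) %% m = if y == 0 then m - 1 else y - 1.
  move=> ym; case: eqP => [->|y0]; first by rewrite addn0 modn_small //; lia.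
  have -> : m - 1 + y = m + (y - 1) by lia.
  by rewrite modnDl modn_small //; lia.
have inj y z : y < m -> z < m ->
    skolem_op m (m - 1) y = skolem_op m (m - 1) z -> y = z.
  move=> ym zm; rewrite /skolem_op !modE //.
  by do !case: ifP; lia.
have hasx : has (fun y => skolem_op m (m - 1) y == x) (iota 0 m).
  pose r := if x < m./2 then 2 * x else 2 * x + 1 - m.
  have rm : r < m by rewrite /r; case: ifP; lia.
  apply/hasP; exists (if r == m - 1 then 0 else r.+1).
    by rewrite mem_iota; case: ifP; lia.
  rewrite /skolem_op modE; last by case: ifP; lia.
  have -> : (if (if r == m - 1 then 0 else r.+1) == 0 then m - 1
             else (if r == m - 1 then 0 else r.+1) - 1) = r.
    by case: (r =P m - 1) => //= _; lia.
  by rewrite /r; case: (ltnP x m./2) => ?; case: ifP; lia.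
have solm : skolem_sol m x < m.
  by move: hasx; rewrite has_find size_iota.
have solE : skolem_op m (m - 1) (skolem_sol m x) = x.
  by have /eqP := nth_find 0 hasx; rewrite nth_iota.
by split=> // y ym yx; apply: inj => //; rewrite solE.
Qed.

(* Main.v *)
(** Writing f r = r/2 or (r + m - 1)/2 according to the parity of r, f permutes
    [0, m-1], and x (+) y = f ((x + y) mod m), so in x (+) y = z any one of x, y
    and z is determined by the other two.  Moreover x (+) x is x if x < m/2 and
    x - m/2 otherwise: the pairs (x, i), (x (+) x, i+1) missed by the Type 2
    blocks are covered by Types 1 and 3 respectively.  Hence the unique block
    through two points can be written down, and it suffices that every block is
    recovered from each pair of its points.  With g the inverse of f, the
    mapping sends (x, 1) to 2m + 1 + ((g x + 2) mod m), so the sum bounds become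
    linear arithmetic; the block of (0, 0) and (m-1, 0) has sum 3m + 1. *)

Require Import Defs.
From mathcomp Require Import all_boot finmap zify.

Set Implicit Arguments.
Unset Strict Implicit.
Unset Printing Implicit Defensive.

Local Open Scope fset_scope.
Local Open Scope nat_scope.

(** * Sets with two or three elements *)

Lemma block_sum3 (a b c : nat) : a != b -> a != c -> b != c ->
  block_sum [fset a; b; c] = a + b + c.
Proof.
move=> ab ac bc; rewrite /block_sum fsetUC big_fsetU1 /=; last first.
  by rewrite !inE negb_or eq_sym ac eq_sym bc.
rewrite big_fsetU1 ?inE //= big_seq_fset1; lia.
Qed.

Lemma card_fset3 (T : choiceType) (a b c : T) : a != b -> a != c -> b != c ->
  #|` [fset a; b; c]| = 3.
Proof.
move=> ab ac bc; rewrite fsetUC cardfsU1 cardfs2 ab !inE negb_or.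
by rewrite eq_sym ac eq_sym bc.
Qed.

Lemma cardfs2_pair (T : choiceType) (P : {fset T}) : #|` P| = 2 ->
  exists a b, a != b /\ P = [fset a; b].
Proof.
move=> P2; have /fset0Pn[a aP] : P != fset0 by rewrite -cardfs_gt0 P2.
have /eqP/cardfs1P[b Pb] : #|` P `\ a| = 1.
  by move: P2; rewrite (cardfsD1 a) aP => -[].
exists a, b; split; last by rewrite -(fsetD1K aP) Pb.
by have: b \in P `\ a by [rewrite Pb !inE]; rewrite !inE eq_sym => /andP[].
Qed.

Lemma imfset3 (T U : choiceType) (f : T -> U) (a b c : T) :
  f @` [fset a; b; c] = [fset f a; f b; f c].
Proof. by rewrite !imfsetU !imfset_fset1. Qed.

(** * Explicit inverses and explicit joining blocks *)

Definition skolem_half (m r : nat) : nat :=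
  if odd r then (r + m - 1)./2 else r./2.

(** [skolem_half] is the permutation f of [0, m-1] hidden in [skolem_op], and this is its inverse g;
    [skolem_doubleK] and [skolem_halfK] are the two cancellations. *)
Definition skolem_double (m z : nat) : nat :=
  if z < m./2 then 2 * z else 2 * z + 1 - m.

(* The solution y of x (+) y = z. *)
Definition skolem_diff (m z x : nat) : nat :=
  if x <= skolem_double m z then skolem_double m z - x
  else skolem_double m z + m - x.

Definition valid_point (m : nat) (p : skolem_point) : bool :=
  if p is Some (x, i) then (x < m) && (i < 3) else true.

(* The block through (x, i) and (z, i + 1). *)
Definition mixed_block (m x z i : nat) : {fset skolem_point} :=
  let y := skolem_diff m z x in
  if y != x then skolem_block2 m x y i
  else if x < m./2 then skolem_block1 x else skolem_block3 m (x - m./2) i.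

(* i + 2 is i - 1 modulo 3. *)
Definition infty_block (m x i : nat) : {fset skolem_point} :=
  if x < m./2 then skolem_block3 m x ((i + 2) %% 3)
  else skolem_block3 m (x - m./2) i.

(** Two distinct residues modulo 3 are consecutive in exactly one order, so the last branch has i =
    j + 1 modulo 3. Values at equal points, such as [fset0], are placeholders: [joining_blockP] and
    [joining_block_unique] assume [p != q]. *)
Definition joining_block (m : nat) (p q : skolem_point) : {fset skolem_point} :=
  match p, q with
  | None, None => fset0
  | None, Some (x, i) | Some (x, i), None => infty_block m x i
  | Some (x, i), Some (y, j) =>
      if i == j then skolem_block2 m x y i
      else if j == i.+1 %% 3 then mixed_block m x y i
      else mixed_block m y x j
  end.

(** The intervals [0, m-1], {m}, [m+1, 2m] and [2m+1, 3m] come from level 0, infinity, level 2 and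
    level 1. On the last one the shift by 2 modulo m is undone before f is applied. *)
Definition skolem_unmap (m a : nat) : skolem_point :=
  if a < m then pt (m - 1 - a) 0
  else if a == m then infty
  else if a < 2 * m + 1 then pt (skolem_double m (a - m - 1)) 2
  else let b := a - (2 * m + 1) in
    pt (skolem_half m (if b < 2 then b + (m - 2) else b - 2)) 1.

Section Skolem.

Variable m : nat.
Hypothesis m_even : ~~ odd m.
Hypothesis m_gt0 : 0 < m.

(** * The quasigroup operation and its diagonal *)

(** Since x + y < 2m, one conditional subtraction replaces the residue, which brings the operation
    within reach of linear arithmetic. *)
Lemma skolem_opE x y : x < m -> y < m ->
  skolem_op m x y = skolem_half m (if x + y < m then x + y else x + y - m).
Proof.
move=> xm ym; rewrite /skolem_op -/(skolem_half m _); congr skolem_half.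
case: ltnP => s; first exact: modn_small.
by rewrite -[in LHS](subnK s) modnDr modn_small //; lia.
Qed.

Lemma skolem_opC x y : skolem_op m x y = skolem_op m y x.
Proof. by rewrite /skolem_op addnC. Qed.

Lemma skolem_op_lt x y : x < m -> y < m -> skolem_op m x y < m.
Proof. by move=> xm ym; rewrite skolem_opE // /skolem_half; do !case: ifP; lia. Qed.

Lemma skolem_doubleK z : z < m -> skolem_half m (skolem_double m z) = z.
Proof. by rewrite /skolem_half /skolem_double; do !case: ifP; lia. Qed.

Lemma skolem_diffP x y z : x < m -> y < m -> z < m ->
  skolem_op m x y = z <-> y = skolem_diff m z x.
Proof.
move=> xm ym zm; rewrite skolem_opE // /skolem_half /skolem_diff /skolem_double.
by split; do !case: ifP; lia.
Qed.

Lemma skolem_diff_lt z x : z < m -> x < m -> skolem_diff m z x < m.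
Proof.
by move=> zm xm; rewrite /skolem_diff /skolem_double; do !case: ifP; lia.
Qed.

Lemma skolem_op_diag x : x < m ->
  skolem_op m x x = if x < m./2 then x else x - m./2.
Proof. by move=> xm; rewrite skolem_opE // /skolem_half; do !case: ifP; lia. Qed.

Lemma skolem_block2C x y i : skolem_block2 m x y i = skolem_block2 m y x i.
Proof. by rewrite /skolem_block2 skolem_opC [[fset pt x i; pt y i]]fsetUC. Qed.

(** * Existence of a block through two points *)

Variant skolem_block_spec : {fset skolem_point} -> Prop :=
| SkolemBlock1 x of x < m./2 : skolem_block_spec (skolem_block1 x)
| SkolemBlock2 x y i of x < m & y < m & x != y & i < 3 :
    skolem_block_spec (skolem_block2 m x y i)
| SkolemBlock3 x i of x < m./2 & i < 3 :
    skolem_block_spec (skolem_block3 m x i).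

(** The condition x < y of Type 2 is relaxed to x != y, harmless by [skolem_block2C], so that later
    arguments need not order the pair. *)
Lemma skolem_blocksP B : B \in skolem_blocks m <-> skolem_block_spec B.
Proof.
rewrite /skolem_blocks !in_fsetU; split.
- case/orP; first case/orP.
  + case/imfsetP => x /=; rewrite mem_iota => xm ->.
    exact: SkolemBlock1.
  + case/bigfcupP => i; rewrite andbT mem_iota => i3.
    case/imfset2P => x /= xm [y]; rewrite !inE => /andP[ym xy] ->.
    move: xm ym; rewrite !mem_iota => xm ym; apply: SkolemBlock2 => //; lia.
  + case/imfset2P => x /= xm [i i3 ->].
    move: xm i3; rewrite mem_iota !inE => xm i3; apply: SkolemBlock3; lia.
- case=> [x xm|x y i xm ym xy i3|x i xm i3].
  + by rewrite in_imfset //= mem_iota.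
  + have W a b : a < b -> b < m -> skolem_block2 m a b i \in
       \bigcup_(i <- iota 0 3)
        [fset skolem_block2 m x y i | x in iota 0 m, y in iota 0 m & x < y].
      move=> ab bm; apply/bigfcupP; exists i; first by rewrite andbT mem_iota.
      apply/imfset2P; exists a; first by rewrite /= mem_iota; lia.
      by exists b; rewrite // !inE mem_iota ab andbT; lia.
    case: (ltngtP x y) xy => // xy _; first by rewrite W ?orbT.
    by rewrite skolem_block2C W ?orbT.
  + apply/orP; right; apply/imfset2P; exists x; first by rewrite /= mem_iota.
    by exists i; [rewrite -[_ \in _]/(i \in iota 0 3) mem_iota|].
Qed.

Lemma mixed_blockP x z i : x < m -> z < m -> i < 3 ->
  [/\ skolem_block_spec (mixed_block m x z i), pt x i \in mixed_block m x z i
    & pt z (i.+1 %% 3) \in mixed_block m x z i].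
Proof.
move=> xm zm i3; rewrite /mixed_block.
have ym := skolem_diff_lt zm xm.
have /(skolem_diffP xm ym zm) := erefl (skolem_diff m z x).
move: (skolem_diff m z x) ym => y ym opE.
case: (eqVneq y x) opE => [->|yx] opE /=; last first.
  split; first by apply: SkolemBlock2 => //; rewrite eq_sym.
    by rewrite !inE eqxx.
  by rewrite /skolem_block2 opE !inE eqxx !orbT.
move: opE; rewrite skolem_op_diag //; case: ltnP => xh zE; rewrite -zE.
  split; first exact: SkolemBlock1.
    by case: i i3 => [|[|[|]]] // _; rewrite !inE eqxx ?orbT.
  by case: i i3 => [|[|[|]]] // _; rewrite !inE eqxx ?orbT.
split; first by apply: SkolemBlock3 => //; lia.
  by rewrite /skolem_block3 subnK // !inE eqxx orbT.
by rewrite /skolem_block3 !inE eqxx !orbT.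
Qed.

Lemma infty_blockP x i : x < m -> i < 3 ->
  [/\ skolem_block_spec (infty_block m x i), infty \in infty_block m x i
    & pt x i \in infty_block m x i].
Proof.
move=> xm i3; rewrite /infty_block /skolem_block3; case: ltnP => xh.
  split; first by apply: SkolemBlock3 => //; rewrite ltn_pmod.
    by rewrite !inE eqxx.
  by case: i i3 => [|[|[|]]] // _; rewrite !inE eqxx !orbT.
split; first by apply: SkolemBlock3 => //; lia.
  by rewrite !inE eqxx.
by rewrite subnK // !inE eqxx orbT.
Qed.

Lemma joining_blockP p q : valid_point m p -> valid_point m q -> p != q ->
  [/\ skolem_block_spec (joining_block m p q), p \in joining_block m p q
    & q \in joining_block m p q].
Proof.
case: p q => [[x i]|] [[y j]|] //= => [/andP[xm i3]|/andP[xm i3] _|_] //.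
- case/andP=> ym j3; case: (eqVneq i j) => [<-|ij] neq.
    split; rewrite ?inE ?eqxx ?orbT //; apply: SkolemBlock2 => //.
    by apply: contraNneq neq => ->.
  case: eqP => [->|ji]; first by case: (mixed_blockP xm ym i3).
  have -> : i = j.+1 %% 3.
    by case: i j i3 j3 ij ji {neq} => [|[|[|]]] [|[|[|]]].
  by case: (mixed_blockP ym xm j3).
- by case: (infty_blockP xm i3).
- by case/andP=> ym j3; case: (infty_blockP ym j3).
Qed.

Lemma joining_blockC p q : valid_point m p -> valid_point m q ->
  joining_block m p q = joining_block m q p.
Proof.
case: p q => [[x i]|] [[y j]|] //= /andP[xm i3] /andP[ym j3].
case: (eqVneq i j) => [<-|]; first exact: skolem_block2C.
by case: i j i3 j3 => [|[|[|]]] [|[|[|]]].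
Qed.

(** * Recovering a block from each pair of its points, and the sum bounds *)

Lemma mixed_blockE x y i : x < m -> y < m -> x != y ->
  mixed_block m x (skolem_op m x y) i = skolem_block2 m x y i.
Proof.
move=> xm ym xy; rewrite /mixed_block.
have /(skolem_diffP xm ym (skolem_op_lt xm ym)) <- := erefl (skolem_op m x y).
by rewrite eq_sym xy.
Qed.

Lemma mixed_block_diag x i : x < m ->
  mixed_block m x (if x < m./2 then x else x - m./2) i =
  if x < m./2 then skolem_block1 x else skolem_block3 m (x - m./2) i.
Proof.
move=> xm; rewrite /mixed_block -skolem_op_diag //.
have /(skolem_diffP xm xm (skolem_op_lt xm xm)) <- := erefl (skolem_op m x x).
by rewrite eqxx.
Qed.

(** One case analysis on the block types then serves three purposes: blocks of size 3, uniqueness of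
    the block through two points, and the lower bound on sums. *)
Variant triple_spec (B : {fset skolem_point}) : Prop :=
  TripleSpec p q r of B = [fset p; q; r]
  & valid_point m p & valid_point m q & valid_point m r
  & p != q & p != r & q != r
  & joining_block m p q = B & joining_block m p r = B & joining_block m q r = B
  & 3 * m + 1 <= skolem_map m p + skolem_map m q + skolem_map m r.

Lemma skolem_map_infty : skolem_map m infty = m.
Proof. by []. Qed.

Lemma skolem_map0 x : skolem_map m (pt x 0) = m - 1 - x.
Proof. by []. Qed.

(** The equation x = (m-1) (+) y means y - 1 = g x modulo m, so 2m + 2 + y is 2m + 1 + (g x + 2),
    reduced when g x = m - 1. The exceptional x = m/2 - 1 is the one with g x = m - 2, where y = m -
    1 would give 3m + 1, out of range; it wraps around to 2m + 1. *)
Lemma skolem_map1 x : x < m ->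
  skolem_map m (pt x 1) = 2 * m + 1 +
   (if skolem_double m x < m - 2 then skolem_double m x + 2
    else skolem_double m x - (m - 2)).
Proof.
move=> xm; rewrite /skolem_map /=; have [ym + _] := skolem_solP m_even xm.
move: (skolem_sol m x) ym => y ym; rewrite skolem_opE; try lia.
rewrite /skolem_half /skolem_double; do !case: ifP; lia.
Qed.

Lemma skolem_map2 x : x < m -> skolem_map m (pt x 2) = m + 1 + skolem_half m x.
Proof. by move=> xm; rewrite /skolem_map /= skolem_opE // add0n xm. Qed.

Arguments skolem_map : simpl never.

Lemma pt_eq x i y j : (pt x i == pt y j) = (x == y) && (i == j).
Proof. by []. Qed.

Lemma skolem_block_triple B : skolem_block_spec B -> triple_spec B.
Proof.
case=> [x xh|x y i xm ym xy i3|x i xh i3].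
- have xm : x < m by lia.
  have D i := mixed_block_diag i xm; rewrite xh in D.
  exists (pt x 0) (pt x 1) (pt x 2); rewrite ?pt_eq ?andbF //= ?xm //.
  rewrite skolem_map0 skolem_map1 // skolem_map2 //.
  rewrite /skolem_half /skolem_double; do !case: ifP; lia.
- have zm := skolem_op_lt xm ym.
  have E := mixed_blockE i xm ym xy.
  have yx : y != x by rewrite eq_sym.
  (* The pair (y, i), (z, i+1) must also give back x, hence the exchanged copy of [E]. *)
  have E' := mixed_blockE i ym xm yx; rewrite skolem_opC skolem_block2C in E'.
  exists (pt x i) (pt y i) (pt (skolem_op m x y) (i.+1 %% 3)); rewrite ?pt_eq //=;
    rewrite ?xm ?ym ?zm ?i3 ?eqxx //=.
  + by case: i i3 {E E'} => [|[|[|]]].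
  + by rewrite (negPf xy).
  + by case: i i3 {E E'} => [|[|[|]]]; rewrite //= ?andbF.
  + by case: i i3 {E E'} => [|[|[|]]]; rewrite //= ?andbF.
  + by case: i i3 E {E'} => [|[|[|]]].
  + by case: i i3 E' {E} => [|[|[|]]].
  + case: i i3 {E E'} => [|[|[|//]]] _.
    (* With s = (x + y) mod m the sum is 4m - 1 - (x + y) + ((s + 2) mod m). It drops below 3m + 1
       only for x + y = 2m - 2, which [x != y] excludes. *)
    * rewrite !skolem_map0 skolem_map1 // skolem_opE // /skolem_half /skolem_double; do !case: ifP; lia.
    (* Two points of level 1 already contribute at least 4m + 2. *)
    * rewrite !skolem_map1 //; lia.
    (* The sum is 3m + 1 + f x + f y - f ((x + y) mod m), and f is subadditive modulo m. *)
    * rewrite skolem_map0 !skolem_map2 // skolem_opE // /skolem_half; do !case: ifP; lia.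
- have xm : x < m by lia.
  have xhm : x + m./2 < m by lia.
  (* As (x + m/2) (+) (x + m/2) = x, this diagonal case yields the Type 3 block. *)
  have D := mixed_block_diag i xhm.
  rewrite ltnNge leq_addl /= addnK in D.
  exists infty (pt (x + m./2) i) (pt x (i.+1 %% 3)); rewrite ?pt_eq //=.
  + by rewrite xhm.
  + by rewrite xm ltn_pmod.
  + by case: i i3 {D} => [|[|[|]]]; rewrite //= ?andbF.
  + by rewrite /infty_block ltnNge leq_addl addnK.
  + by rewrite /infty_block xh; case: i i3 {D} => [|[|[|]]].
  + by case: i i3 D => [|[|[|]]].
  + case: i i3 {D} => [|[|[|//]]] _.
    * rewrite skolem_map_infty skolem_map0 skolem_map1 //; lia.
    * rewrite skolem_map_infty skolem_map1 // skolem_map2 //; lia.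
    (* The sum is 3m + f (x + m/2) - x. If x + m/2 is odd, f is at least m/2 > x there; if it is
       even, then x <= m/2 - 2 and half of x + m/2 is at least x + 1. *)
    * rewrite skolem_map_infty skolem_map0 skolem_map2 // /skolem_half; case: ifP; lia.
Qed.

(** * The mapping as a bijection onto [0, 3m] *)

Lemma skolem_halfK r : r < m -> skolem_double m (skolem_half m r) = r.
Proof. by rewrite /skolem_half /skolem_double; do !case: ifP; lia. Qed.

Lemma skolem_half_lt r : r < m -> skolem_half m r < m.
Proof. by rewrite /skolem_half; case: ifP; lia. Qed.

Lemma skolem_double_lt z : z < m -> skolem_double m z < m.
Proof. by rewrite /skolem_double; case: ifP; lia. Qed.

Lemma skolem_map_lt p : valid_point m p -> skolem_map m p < 3 * m + 1.
Proof.
case: p => [[x i] /andP[xm]|_]; last by rewrite /skolem_map; lia.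
case: i => [|[|[|//]]] _; rewrite -/(pt x _).
- by rewrite skolem_map0; lia.
- have := skolem_double_lt xm; rewrite skolem_map1 //; case: ifP; lia.
- by have := skolem_half_lt xm; rewrite skolem_map2 //; lia.
Qed.

Lemma skolem_mapK p : valid_point m p -> skolem_unmap m (skolem_map m p) = p.
Proof.
rewrite /skolem_unmap.
case: p => [[x i] /andP[xm]|_]; last by rewrite /skolem_map ltnn eqxx.
case: i => [|[|[|//]]] _; rewrite -/(pt x _).
- by rewrite skolem_map0 ifT; last lia; congr (pt _ _); lia.
- have gm := skolem_double_lt xm; rewrite skolem_map1 //.
  rewrite ifF; last lia; rewrite ifF; last lia; rewrite ifF; last lia.
  rewrite -[in RHS](skolem_doubleK xm); congr (pt (skolem_half m _) _).
  by rewrite addKn; do !case: ifP; lia.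
- have hm := skolem_half_lt xm; rewrite skolem_map2 //.
  rewrite ifF; last lia; rewrite ifF; last lia; rewrite ifT; last lia.
  congr (pt _ _); rewrite -[RHS](skolem_halfK xm); congr skolem_double; lia.
Qed.

Lemma skolem_unmapK a : a < 3 * m + 1 ->
  valid_point m (skolem_unmap m a) /\ skolem_map m (skolem_unmap m a) = a.
Proof.
move=> an; rewrite /skolem_unmap.
case: ifP => am; first by rewrite skolem_map0 /=; split; lia.
case: eqP => [->//|an_m].
case: ifP => a2m.
  have zm : a - m - 1 < m by lia.
  have dm := skolem_double_lt zm.
  by rewrite skolem_map2 // skolem_doubleK //= dm; split; lia.
set b := a - _; set r := (if _ then _ else _).
have rm : r < m by rewrite /r /b; case: ifP; lia.
have hm := skolem_half_lt rm.
rewrite skolem_map1 // skolem_halfK //= hm; split=> //.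
by rewrite /r /b; do !case: ifP; lia.
Qed.

Lemma skolem_map_inj p q : valid_point m p -> valid_point m q ->
  skolem_map m p = skolem_map m q -> p = q.
Proof. by move=> vp vq pq; rewrite -(skolem_mapK vp) pq skolem_mapK. Qed.

(** * Uniqueness of the joining block, and images of blocks *)

Lemma joining_block_unique B p q : skolem_block_spec B -> p \in B -> q \in B ->
  p != q -> B = joining_block m p q.
Proof.
move=> /skolem_block_triple[a b c -> va vb vc _ _ _ Eab Eac Ebc _].
rewrite !inE -!orbA => /or3P[] /eqP-> /or3P[] /eqP->; rewrite ?eqxx // => _.
- by rewrite joining_blockC.
- by rewrite joining_blockC.
- by rewrite joining_blockC.
Qed.

Lemma skolem_block_valid B p : skolem_block_spec B -> p \in B -> valid_point m p.
Proof.
move=> /skolem_block_triple[a b c -> va vb vc _ _ _ _ _ _ _].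
by rewrite !inE -!orbA => /or3P[] /eqP->.
Qed.

Lemma skolem_map_block B : skolem_block_spec B ->
  [/\ {subset skolem_map m @` B <= [pred a | a < 3 * m + 1]},
      #|` skolem_map m @` B| = 3 & 3 * m + 1 <= block_sum (skolem_map m @` B)].
Proof.
move=> BB; have BV := skolem_block_valid BB.
split.
- by move=> _ /imfsetP[p /= /BV pv ->]; exact: skolem_map_lt.
- case: (skolem_block_triple BB) => a b c -> va vb vc ab ac bc _ _ _ _.
  by rewrite imfset3 card_fset3 //; apply: contra_neq (skolem_map_inj _ _) _.
- case: (skolem_block_triple BB) => a b c -> va vb vc ab ac bc _ _ _ le.
  by rewrite imfset3 block_sum3 //; apply: contra_neq (skolem_map_inj _ _) _.
Qed.

End Skolem.

Theorem theorem2 (n : nat) (hn : 7 <= n) (hmod : n = 1 %[mod 6]) :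
  let m := (n - 1) %/ 3 in
  let Bs := [fset skolem_map m @` B | B : {fset skolem_point} in skolem_blocks m] in
  steiner_triple_system n [fset x in iota 0 n] Bs /\ is_min_sum Bs n.
Proof.
move=> m Bs.
have nE : n = 3 * m + 1 by rewrite /m; lia.
have m_even : ~~ odd m by rewrite /m; lia.
have m_gt0 : 0 < m by rewrite /m; lia.
have memBs B : B \in Bs -> exists2 B', skolem_block_spec m B' & B = skolem_map m @` B'.
  by case/imfsetP=> B' /= /(skolem_blocksP m_even)-/(_ m_gt0) BB ->; exists B'.
have inBs B : skolem_block_spec m B -> skolem_map m @` B \in Bs.
  by move=> BB; apply: in_imfset => /=; apply/skolem_blocksP.
split; split.
- by rewrite card_imfset //= undup_id ?size_iota // iota_uniq.
- move=> B /memBs[B' BB ->]; have [sub -> _] := skolem_map_block m_even m_gt0 BB.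
  by split=> //; apply/fsubsetP=> a /sub; rewrite !inE mem_iota /= nE.
- move=> P /fsubsetP PX /cardfs2_pair[a [b [ab PE]]].
  have [aP bP] : a \in P /\ b \in P by rewrite PE !inE !eqxx orbT.
  have an : a < 3 * m + 1 by have := PX _ aP; rewrite !inE mem_iota nE.
  have bn : b < 3 * m + 1 by have := PX _ bP; rewrite !inE mem_iota nE.
  have [vp pa] := skolem_unmapK m_even m_gt0 an.
  have [vq qb] := skolem_unmapK m_even m_gt0 bn.
  move: (skolem_unmap m a) (skolem_unmap m b) vp vq pa qb => p q vp vq pa qb.
  have pq : p != q by apply: contraNneq ab => pq; rewrite -pa pq qb.
  have [BB pB qB] := joining_blockP m_even m_gt0 vp vq pq.
  exists (skolem_map m @` joining_block m p q); split.
    split; first exact: inBs.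
    rewrite PE fsubUset !fsub1set -pa -qb.
    by rewrite !in_imfset.
  (* Injectivity identifies the preimages of a and b inside [B'] with p and q, so uniqueness
     transfers from the original points. *)
  move=> _ [/memBs[B' BB' ->]]; rewrite PE fsubUset !fsub1set.
  case/andP=> /imfsetP[p' /= p'B ap'] /imfsetP[q' /= q'B bq'].
  have vp' := skolem_block_valid m_even m_gt0 BB' p'B.
  have vq' := skolem_block_valid m_even m_gt0 BB' q'B.
  rewrite (joining_block_unique m_even m_gt0 BB' (p := p) (q := q)) //.
  + by rewrite (skolem_map_inj m_even m_gt0 vp vp') // pa.
  + by rewrite (skolem_map_inj m_even m_gt0 vq vq') // qb.
- have m1 : m - 1 < m by lia.
  have BB : skolem_block_spec m (skolem_block2 m 0 (m - 1) 0).
    by apply: SkolemBlock2 => //; lia.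
  exists (skolem_map m @` skolem_block2 m 0 (m - 1) 0); first exact: inBs.
  have zm := skolem_op_lt m_even m_gt0 m_gt0 m1.
  (* The images are m - 1, 0 and 2m + 2, since g (0 (+) (m-1)) = m - 1 and m - 1 + 2 is 1 modulo
     m. *)
  rewrite /skolem_block2 imfset3 !skolem_map0 skolem_map1 //.
  rewrite skolem_opE // add0n m1 skolem_halfK //.
  by rewrite block_sum3; do ?case: ifP; lia.
- by move=> B /memBs[B' BB ->]; case: (skolem_map_block m_even m_gt0 BB) => _ _; rewrite -nE.
Qed.
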